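(* For all formulae $A,B$, the following formulae are derivable in $\mathbf{GMALL}$: (1) $\boxdot(A\to B)\to(\boxdot A\to\boxdot B)$; (2) $\boxdot(A\land B)\to(\boxdot A\land\boxdot B)$; (3) $\Diamond(A\land B)\to(\Diamond A\land\Diamond B)$; (4) $(\boxdot A\lor\boxdot B)\to\boxdot(A\lor B)$; (5) $(\Diamond A\lor\Diamond B)\to\Diamond(A\lor B)$.
   Context: Formulae are built from propositional variables and constants $0,1,\bot,\top$ using the connectives $\otimes$, $\oplus$ (multiplicative disjunction, ''par''), $\land$, $\lor$ (additive conjunction and disjunction), $\neg$, $\to$. A sequent $\Gamma\Rightarrow\Delta$ is a pair of finite multisets of formulae; commas denote multiset union. A formula $C$ is derivable in a calculus if the sequent ${}\Rightarrow C$ is derivable. The calculus $\mathbf{GMALL}$ for Multiplicative Additive Linear Logic has the following rules (no cut, weakening or contraction). Axioms: $A\Rightarrow A$; $0\Rightarrow{}$; ${}\Rightarrow 1$; $\bot,\Gamma\Rightarrow\Delta$; $\Gamma\Rightarrow\Delta,\top$. $(R0)$ from $\Gamma\Rightarrow\Delta$ infer $\Gamma\Rightarrow\Delta,0$. $(L1)$ from $\Gamma\Rightarrow\Delta$ infer $1,\Gamma\Rightarrow\Delta$. $(L\otimes)$ from $\Gamma,A,B\Rightarrow\Delta$ infer $A\otimes B,\Gamma\Rightarrow\Delta$. $(R\otimes)$ from $\Gamma\Rightarrow\Delta,A$ and $\Gamma'\Rightarrow\Delta',B$ infer $\Gamma,\Gamma'\Rightarrow\Delta,\Delta',A\otimes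 B$. $(L\oplus)$ from $A,\Gamma\Rightarrow\Delta$ and $B,\Gamma'\Rightarrow\Delta'$ infer $A\oplus B,\Gamma,\Gamma'\Rightarrow\Delta,\Delta'$. $(R\oplus)$ from $\Gamma\Rightarrow\Delta,A,B$ infer $\Gamma\Rightarrow\Delta,A\oplus B$. $(L\land_1),(L\land_2)$ from $A,\Gamma\Rightarrow\Delta$, respectively from $B,\Gamma\Rightarrow\Delta$, infer $A\land B,\Gamma\Rightarrow\Delta$. $(R\land)$ from $\Gamma\Rightarrow\Delta,A$ and $\Gamma\Rightarrow\Delta,B$ infer $\Gamma\Rightarrow\Delta,A\land B$. $(L\lor)$ from $A,\Gamma\Rightarrow\Delta$ and $B,\Gamma\Rightarrow\Delta$ infer $A\lor B,\Gamma\Rightarrow\Delta$. $(R\lor_1),(R\lor_2)$ from $\Gamma\Rightarrow\Delta,A$, respectively from $\Gamma\Rightarrow\Delta,B$, infer $\Gamma\Rightarrow\Delta,A\lor B$. $(L\neg)$ from $\Gamma\Rightarrow\Delta,A$ infer $\neg A,\Gamma\Rightarrow\Delta$. $(R\neg)$ from $A,\Gamma\Rightarrow\Delta$ infer $\Gamma\Rightarrow\Delta,\neg A$. $(L\to)$ from $\Gamma\Rightarrow\Delta,A$ and $B,\Gamma'\Rightarrow\Delta'$ infer $A\to B,\Gamma,\Gamma'\Rightarrow\Delta,\Delta'$. $(R\to)$ from $A,\Gamma\Rightarrow\Delta,B$ infer $\Gamma\Rightarrow\Delta,A\to B$. The Tarskian modalities are the abbreviations $\Diamond A := \neg A\to A$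 and $\boxdot A := \neg\Diamond\neg A$. *)

(* Defs.v *)
From HB Require Import structures.
From mathcomp Require Import all_boot.
From mathcomp Require Import finmap multiset.

Set Implicit Arguments.
Unset Strict Implicit.
Unset Printing Implicit Defensive.

(* [f_zero] and [f_one] are the multiplicative units (of par and tensor);
   [f_bot] and [f_top] are the additive ones. *)
Inductive formula : Type :=
| f_var of nat
| f_zero
| f_one
| f_bot
| f_top
| f_tensor of formula & formula
| f_par of formula & formula
| f_and of formula & formula
| f_or of formula & formula
| f_neg of formula
| f_imp of formula & formula.

(* Encoding into generic trees: [{mset formula}] needs a choiceType. *)
Fixpoint tree_of_formula (A : formula) : GenTree.tree nat :=
  match A with
  | f_var n => GenTree.Leaf n
  | f_zero => GenTree.Node 0 [::]
  | f_one => GenTree.Node 1 [::]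
  | f_bot => GenTree.Node 2 [::]
  | f_top => GenTree.Node 3 [::]
  | f_tensor B C => GenTree.Node 4 [:: tree_of_formula B; tree_of_formula C]
  | f_par B C => GenTree.Node 5 [:: tree_of_formula B; tree_of_formula C]
  | f_and B C => GenTree.Node 6 [:: tree_of_formula B; tree_of_formula C]
  | f_or B C => GenTree.Node 7 [:: tree_of_formula B; tree_of_formula C]
  | f_neg B => GenTree.Node 8 [:: tree_of_formula B]
  | f_imp B C => GenTree.Node 9 [:: tree_of_formula B; tree_of_formula C]
  end.

Fixpoint formula_of_tree (t : GenTree.tree nat) : formula :=
  match t with
  | GenTree.Leaf n => f_var n
  | GenTree.Node 0 [::] => f_zero
  | GenTree.Node 1 [::] => f_one
  | GenTree.Node 2 [::] => f_bot
  | GenTree.Node 3 [::] => f_top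
  | GenTree.Node 4 [:: u; v] => f_tensor (formula_of_tree u) (formula_of_tree v)
  | GenTree.Node 5 [:: u; v] => f_par (formula_of_tree u) (formula_of_tree v)
  | GenTree.Node 6 [:: u; v] => f_and (formula_of_tree u) (formula_of_tree v)
  | GenTree.Node 7 [:: u; v] => f_or (formula_of_tree u) (formula_of_tree v)
  | GenTree.Node 8 [:: u] => f_neg (formula_of_tree u)
  | GenTree.Node 9 [:: u; v] => f_imp (formula_of_tree u) (formula_of_tree v)
  | _ => f_zero
  end.

Lemma tree_of_formulaK : cancel tree_of_formula formula_of_tree.
Proof.
by elim=> //= [B -> C ->|B -> C ->|B -> C ->|B -> C ->|B ->|B -> C ->].
Qed.

HB.instance Definition _ := Countable.copy formula (can_type tree_of_formulaK).

Declare Scope formula_scope.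
Delimit Scope formula_scope with F.
Bind Scope formula_scope with formula.

Notation "0" := f_zero : formula_scope.
Notation "1" := f_one : formula_scope.
Notation "⊥" := f_bot (at level 0) : formula_scope.
Notation "⊤" := f_top (at level 0) : formula_scope.
Notation "¬ A" := (f_neg A) (at level 35, right associativity) : formula_scope.
Notation "A ⊗ B" := (f_tensor A B)
  (at level 40, left associativity) : formula_scope.
Notation "A ⊕ B" := (f_par A B)
  (at level 50, left associativity) : formula_scope.
Notation "A ∧ B" := (f_and A B)
  (at level 60, right associativity) : formula_scope.
Notation "A ∨ B" := (f_or A B)
  (at level 65, right associativity) : formula_scope.
Notation "A → B" := (f_imp A B)
  (at level 70, right associativity) : formula_scope.

Local Open Scope mset_scope.

Reserved Notation "Γ ⇒ Δ" (at level 75, no associativity).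

Implicit Types (A B C : formula) (Γ Δ : {mset formula}).

(* The sequent calculus GMALL.  On multisets, [A +` Γ] adds one occurrence of
   [A] to [Γ], and [`+`] adds multiplicities. *)
Inductive gmall : {mset formula} -> {mset formula} -> Prop :=
| gm_ax (A : formula) : [mset A] ⇒ [mset A]
| gm_L0 : [mset 0%F] ⇒ mset0
| gm_R1 : mset0 ⇒ [mset 1%F]
| gm_Lbot Γ Δ : ⊥%F +` Γ ⇒ Δ
| gm_Rtop Γ Δ : Γ ⇒ ⊤%F +` Δ
| gm_R0 Γ Δ : Γ ⇒ Δ -> Γ ⇒ 0%F +` Δ
| gm_L1 Γ Δ : Γ ⇒ Δ -> 1%F +` Γ ⇒ Δ
| gm_Ltensor A B Γ Δ :
    A +` (B +` Γ) ⇒ Δ -> (A ⊗ B)%F +` Γ ⇒ Δ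
| gm_Rtensor A B Γ Γ' Δ Δ' :
    Γ ⇒ A +` Δ -> Γ' ⇒ B +` Δ' ->
    Γ `+` Γ' ⇒ (A ⊗ B)%F +` (Δ `+` Δ')
| gm_Lpar A B Γ Γ' Δ Δ' :
    A +` Γ ⇒ Δ -> B +` Γ' ⇒ Δ' ->
    (A ⊕ B)%F +` (Γ `+` Γ') ⇒ Δ `+` Δ'
| gm_Rpar A B Γ Δ :
    Γ ⇒ A +` (B +` Δ) -> Γ ⇒ (A ⊕ B)%F +` Δ
| gm_Land1 A B Γ Δ : A +` Γ ⇒ Δ -> (A ∧ B)%F +` Γ ⇒ Δ
| gm_Land2 A B Γ Δ : B +` Γ ⇒ Δ -> (A ∧ B)%F +` Γ ⇒ Δ
| gm_Rand A B Γ Δ :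
    Γ ⇒ A +` Δ -> Γ ⇒ B +` Δ -> Γ ⇒ (A ∧ B)%F +` Δ
| gm_Lor A B Γ Δ :
    A +` Γ ⇒ Δ -> B +` Γ ⇒ Δ -> (A ∨ B)%F +` Γ ⇒ Δ
| gm_Ror1 A B Γ Δ : Γ ⇒ A +` Δ -> Γ ⇒ (A ∨ B)%F +` Δ
| gm_Ror2 A B Γ Δ : Γ ⇒ B +` Δ -> Γ ⇒ (A ∨ B)%F +` Δ
| gm_Lneg A Γ Δ : Γ ⇒ A +` Δ -> (¬ A)%F +` Γ ⇒ Δ
| gm_Rneg A Γ Δ : A +` Γ ⇒ Δ -> Γ ⇒ (¬ A)%F +` Δ
| gm_Limp A B Γ Γ' Δ Δ' :
    Γ ⇒ A +` Δ -> B +` Γ' ⇒ Δ' ->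
    (A → B)%F +` (Γ `+` Γ') ⇒ Δ `+` Δ'
| gm_Rimp A B Γ Δ : A +` Γ ⇒ B +` Δ -> Γ ⇒ (A → B)%F +` Δ
where "Γ ⇒ Δ" := (gmall Γ Δ).

Definition derivable (C : formula) : Prop := mset0 ⇒ [mset C].

Definition tdiamond (A : formula) : formula := (¬ A → A)%F.
Notation "◇ A" := (tdiamond A)
  (at level 35, right associativity) : formula_scope.

Definition tbox (A : formula) : formula := (¬ ◇ ¬ A)%F.
Notation "⊡ A" := (tbox A)
  (at level 35, right associativity) : formula_scope.

(* Main.v *)
From mathcomp Require Import all_boot.
From mathcomp Require Import finmap multiset.
Require Import Defs.

Local Open Scope mset_scope.

(** Up to linear equivalence [◇ A] is [A ⊕ A] and [⊡ A] is [A ⊗ A], so although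
the two modalities are defined through implication and negation, they obey the
sequent rules of par and tensor applied to two copies of [A]:
[gmall_Ldiamond], [gmall_Rdiamond], [gmall_Lbox] and [gmall_Rbox].

A modal premise supplies exactly the two copies that a modal conclusion
consumes, so running a derivation of the underlying sequent twice in parallel is
resource-correct.  This makes [◇] and [⊡] monotone ([tdiamond_mono],
[tbox_mono]), and lets [⊡] be applied throughout a sequent with two premises
([tbox_mono2]).  Distribution of [⊡] over implication is [tbox_mono2] applied to
modus ponens; the other four formulae are monotonicity applied to the
projections from an additive conjunction or the injections into an additive
disjunction, assembled by the two-premise additive rule, whose premises share
their context. *)

Lemma gmall_Ldiamond (A : formula) (Γ Γ' Δ Δ' : {mset formula}) :
  A +` Γ ⇒ Δ -> A +` Γ' ⇒ Δ' -> (◇ A)%F +` (Γ `+` Γ') ⇒ Δ `+` Δ'.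
Proof. by move=> hl hr; apply: gm_Limp => //; apply: gm_Rneg. Qed.

Lemma gmall_Rdiamond (A : formula) (Γ Δ : {mset formula}) :
  Γ ⇒ A +` (A +` Δ) -> Γ ⇒ (◇ A)%F +` Δ.
Proof. by move=> h; apply/gm_Rimp/gm_Lneg. Qed.

Lemma gmall_Lbox (A : formula) (Γ Δ : {mset formula}) :
  A +` (A +` Γ) ⇒ Δ -> (⊡ A)%F +` Γ ⇒ Δ.
Proof. by move=> h; apply/gm_Lneg/gmall_Rdiamond/gm_Rneg/gm_Rneg. Qed.

Lemma gmall_Rbox (A : formula) (Γ Γ' Δ Δ' : {mset formula}) :
  Γ ⇒ A +` Δ -> Γ' ⇒ A +` Δ' -> Γ `+` Γ' ⇒ (⊡ A)%F +` (Δ `+` Δ').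
Proof.
by move=> hl hr; apply/gm_Rneg/gmall_Ldiamond; apply: gm_Lneg.
Qed.

Lemma tdiamond_mono (A B : formula) :
  [mset A] ⇒ [mset B] -> [mset (◇ A)%F] ⇒ [mset (◇ B)%F].
Proof.
rewrite -[[mset A]]msetD0 -[[mset (◇ B)%F]]msetD0 => h.
apply: gmall_Rdiamond; rewrite msetD0.
by have := gmall_Ldiamond _ _ _ _ _ h h; rewrite !msetD0.
Qed.

Lemma tbox_mono2 (A B C : formula) :
  A +` [mset B] ⇒ [mset C] -> (⊡ A)%F +` [mset (⊡ B)%F] ⇒ [mset (⊡ C)%F].
Proof.
move=> h; apply: gmall_Lbox.
rewrite msetDA msetDC -[[mset (⊡ C)%F]]msetD0; apply: gmall_Lbox.
(* Each premise of the right rule gets one copy of [A] and one of [B]. *)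
have -> : B +` (B +` (A +` [mset A])) = (A +` [mset B]) `+` (A +` [mset B]).
  by rewrite msetDA msetDC msetDACA.
by rewrite -[mset0]msetD0; apply: gmall_Rbox; rewrite msetD0.
Qed.

Lemma tbox_mono (A B : formula) :
  [mset A] ⇒ [mset B] -> [mset (⊡ A)%F] ⇒ [mset (⊡ B)%F].
Proof.
move=> h; rewrite -[[mset (⊡ A)%F]]msetD0; apply: gmall_Lbox.
rewrite msetD0 -[[mset (⊡ B)%F]]msetD0 -[mset0]msetD0.
by apply: gmall_Rbox; rewrite msetD0.
Qed.

Lemma derivable_imp (A B : formula) :
  [mset A] ⇒ [mset B] -> derivable (A → B).
Proof.
move=> h; rewrite /derivable -[[mset (A → B)%F]]msetD0.
by apply: gm_Rimp; rewrite !msetD0.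
Qed.

Lemma gmall_and_l (A B : formula) : [mset (A ∧ B)%F] ⇒ [mset A].
Proof.
by rewrite -[[mset (A ∧ B)%F]]msetD0; apply: gm_Land1;
  rewrite msetD0; apply: gm_ax.
Qed.

Lemma gmall_and_r (A B : formula) : [mset (A ∧ B)%F] ⇒ [mset B].
Proof.
by rewrite -[[mset (A ∧ B)%F]]msetD0; apply: gm_Land2;
  rewrite msetD0; apply: gm_ax.
Qed.

Lemma gmall_or_l (A B : formula) : [mset A] ⇒ [mset (A ∨ B)%F].
Proof.
by rewrite -[[mset (A ∨ B)%F]]msetD0; apply: gm_Ror1;
  rewrite msetD0; apply: gm_ax.
Qed.

Lemma gmall_or_r (A B : formula) : [mset B] ⇒ [mset (A ∨ B)%F].
Proof.
by rewrite -[[mset (A ∨ B)%F]]msetD0; apply: gm_Ror2;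
  rewrite msetD0; apply: gm_ax.
Qed.

Lemma derivable_imp_and (A B C : formula) :
  [mset C] ⇒ [mset A] -> [mset C] ⇒ [mset B] -> derivable (C → A ∧ B).
Proof.
move=> hA hB; apply: derivable_imp; rewrite -[[mset (A ∧ B)%F]]msetD0.
by apply: gm_Rand; rewrite msetD0.
Qed.

Lemma derivable_or_imp (A B C : formula) :
  [mset A] ⇒ [mset C] -> [mset B] ⇒ [mset C] -> derivable (A ∨ B → C).
Proof.
move=> hA hB; apply: derivable_imp; rewrite -[[mset (A ∨ B)%F]]msetD0.
by apply: gm_Lor; rewrite msetD0.
Qed.

Lemma gmall_modus_ponens (A B : formula) : (A → B)%F +` [mset A] ⇒ [mset B].
Proof.
rewrite -[X in _ +` X]msetD0 -[X in _ ⇒ X]mset0D.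
by apply: gm_Limp; rewrite msetD0; apply: gm_ax.
Qed.

Theorem mainTheorem4 (A B : formula) :
  derivable (⊡ (A → B) → (⊡ A → ⊡ B)) /\
  derivable (⊡ (A ∧ B) → (⊡ A ∧ ⊡ B)) /\
  derivable (◇ (A ∧ B) → (◇ A ∧ ◇ B)) /\
  derivable ((⊡ A ∨ ⊡ B) → ⊡ (A ∨ B)) /\
  derivable ((◇ A ∨ ◇ B) → ◇ (A ∨ B)).
Proof.
split.
  apply: derivable_imp; rewrite -[X in _ ⇒ X]msetD0; apply: gm_Rimp.
  by rewrite msetD0 msetDC; apply/tbox_mono2/gmall_modus_ponens.
split; first by apply: derivable_imp_and; apply: tbox_mono;
  [apply: gmall_and_l | apply: gmall_and_r].
split; first by apply: derivable_imp_and; apply: tdiamond_mono;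
  [apply: gmall_and_l | apply: gmall_and_r].
split; first by apply: derivable_or_imp; apply: tbox_mono;
  [apply: gmall_or_l | apply: gmall_or_r].
by apply: derivable_or_imp; apply: tdiamond_mono;
  [apply: gmall_or_l | apply: gmall_or_r].
Qed.
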